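(* Consider an imprecise Markov chain with finite state set $\mathcal{X}$ and time horizon $N$. For any real-valued map $h$ on $\mathcal{X}$, any $1\le\ell<n\le N$ and all $x_\ell\in\mathcal{X}$: $$\overline{E}_{n\mid\ell}(h\mid x_\ell)=\overline{T}_\ell\overline{T}_{\ell+1}\cdots\overline{T}_{n-1}h(x_\ell)\quad\text{and}\quad\overline{E}_n(h)=\overline{E}_1(\overline{T}_1\overline{T}_2\cdots\overline{T}_{n-1}h).$$
   Context: $\mathcal{X}$ is a finite non-empty set, $\mathcal{L}(\mathcal{Y})$ is the set of real-valued maps on a finite set $\mathcal{Y}$. A credal set is a non-empty closed convex set of probability mass functions on $\mathcal{X}$. We write $x_{k:\ell}=(x_k,\dots,x_\ell)$. An imprecise Markov chain with state set $\mathcal{X}$ and time horizon $N$ consists of a credal set $\mathcal{M}_1$ (for the initial state $X(1)$) and, for each $n\in\{1,\dots,N-1\}$ and $x\in\mathcal{X}$, a credal set $\mathcal{Q}_n(\cdot\mid x)$ (for the state $X(n+1)$ given $X(n)=x$). For $h\in\mathcal{L}(\mathcal{X})$: $\overline{E}_1(h)=\max\{\sum_{x}h(x)m(x): m\in\mathcal{M}_1\}$, and the upper transition operator $\overline{T}_n:\mathcal{L}(\mathcal{X})\to\mathcal{L}(\mathcal{X})$ is $\overline{T}_nh(x)=\max\{\sum_{z}h(z)q(z):q\in\mathcal{Q}_n(\cdot\mid x)\}$. A compatible probability tree is a choice of some $m_1\in\mathcal{M}_1$ and, for every $k\in\{1,\dots,N-1\}$ and every $x_{1:k}\in\mathcal{X}^k$,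 of some $q(\cdot\mid x_{1:k})\in\mathcal{Q}_k(\cdot\mid x_k)$ (the choice may depend on the whole of $x_{1:k}$). Its expectations are, for $f\in\mathcal{L}(\mathcal{X}^N)$, $$E(f\mid x_{1:n})=\sum_{x_{n+1:N}\in\mathcal{X}^{N-n}}f(x_{1:n},x_{n+1:N})\prod_{k=n}^{N-1}q(x_{k+1}\mid x_{1:k}),$$ $$E(f)=\sum_{x_{1:N}\in\mathcal{X}^N}f(x_{1:N})\,m_1(x_1)\prod_{k=1}^{N-1}q(x_{k+1}\mid x_{1:k}).$$ $\overline{E}(f\mid x_{1:n})$ and $\overline{E}(f)$ denote the maxima of $E(f\mid x_{1:n})$ and $E(f)$, respectively, over all compatible probability trees. For $h\in\mathcal{L}(\mathcal{X})$ and $n\in\{1,\dots,N\}$, let $f\in\mathcal{L}(\mathcal{X}^N)$ be given by $f(x_{1:N})=h(x_n)$. Then $\overline{E}_n(h)=\overline{E}(f)$, and for $1\le\ell<n$, $\overline{E}_{n\mid\ell}(h\mid x_\ell)=\overline{E}(f\mid x_{1:\ell})$, the value of which does not depend on $x_{1:\ell-1}$. *)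

(* Defs.v *)
From HB Require Import structures.
From mathcomp Require Import all_boot all_order all_algebra.
From mathcomp Require Import all_classical all_reals all_analysis.

Set Implicit Arguments.
Unset Strict Implicit.
Unset Printing Implicit Defensive.

Import Order.TTheory GRing.Theory Num.Theory.
Import numFieldNormedType.Exports.

Local Open Scope classical_set_scope.
Local Open Scope ring_scope.

(* The maximum of S, with dummy value 0 if S has no greatest element; the
   lemmas at the end of the file show that the maxima used here do exist. *)
Definition max_of (R : realType) (S : set R) : R := xget 0 (S `&` ubound S).

Definition is_pmf (R : realType) (X : finType) (m : X -> R) : Prop :=
  (forall x, 0 <= m x) /\ \sum_x m x = 1.

(* Since X is finite, pointwise convergence is convergence in R^X. *)
Definition credal_set (R : realType) (X : finType) (M : set (X -> R)) : Prop :=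
  [/\ M !=set0,
      @closed {ptws X -> R} M,
      @convex_set R (X -> R^o) M
    & M `<=` @is_pmf R X].

(* Times are numbered from 1, as in x_1, ..., x_N; the values of imc_trans at
   times outside {1, ..., N - 1} are irrelevant. *)
Record imc (R : realType) (X : finType) (N : nat) := Imc {
  horizon_gt0 : (0 < N)%N;
  imc_init : set (X -> R);
  imc_trans : nat -> X -> set (X -> R);
  imc_init_credal : credal_set imc_init;
  imc_trans_credal :
    forall n x, (0 < n < N)%N -> credal_set (imc_trans n x)
}.

Definition upper_init (R : realType) (X : finType) (N : nat) (C : imc R X N)
    (h : X -> R) : R :=
  max_of [set \sum_x h x * m x | m in imc_init C].

Definition upper_trans (R : realType) (X : finType) (N : nat) (C : imc R X N)
    (n : nat) (h : X -> R) : X -> R :=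
  fun x => max_of [set \sum_z h z * q z | q in imc_trans C n x].

(* T_l (T_(l+1) (... (T_(n-1) h))) *)
Definition upper_trans_iter (R : realType) (X : finType) (N : nat)
    (C : imc R X N) (l n : nat) (h : X -> R) : X -> R :=
  foldr (upper_trans C) h (index_iota l n).

(* tree_trans s is q(. | s), where the history x_1, ..., x_k is encoded as the
   sequence s of size k; only sizes 1, ..., N - 1 are relevant. *)
Record prob_tree (R : realType) (X : finType) := ProbTree {
  tree_init : X -> R;
  tree_trans : seq X -> X -> R
}.

Definition compatible (R : realType) (X : finType) (N : nat) (C : imc R X N)
    (t : prob_tree R X) : Prop :=
  imc_init C (tree_init t) /\
  forall (s : seq X) (x : X), ((size s).+1 < N)%N ->
    imc_trans C (size s).+1 x (tree_trans t (rcons s x)).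

(* E(f | s) for a history s: the sum over the continuations of s up to time N
   is written as a sum over the paths y having s as a prefix.  As ordinals
   start from 0, x_(k+1) is tnth y k, and x_1, ..., x_k is take k y. *)
Definition tree_cexp (R : realType) (X : finType) (N : nat)
    (t : prob_tree R X) (f : N.-tuple X -> R) (s : seq X) : R :=
  \sum_(y : N.-tuple X | prefix s y)
    f y * \prod_(k < N | (size s <= k)%N) tree_trans t (take k y) (tnth y k).

Lemma time_index_subproof (N n : nat) : (0 < n <= N)%N -> (n.-1 < N)%N.
Proof. by case: n. Qed.

(* The position in an N-tuple of its n-th component, counting from 1. *)
Definition time_index (N n : nat) (Hn : (0 < n <= N)%N) : 'I_N :=
  Ordinal (time_index_subproof Hn).

Definition tree_exp (R : realType) (X : finType) (N : nat) (N_gt0 : (0 < N)%N)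
    (t : prob_tree R X) (f : N.-tuple X -> R) : R :=
  \sum_(y : N.-tuple X)
    f y * (tree_init t (tnth y (Ordinal N_gt0)) *
      \prod_(k < N | (0 < k)%N) tree_trans t (take k y) (tnth y k)).

Definition upper_cexp (R : realType) (X : finType) (N : nat) (C : imc R X N)
    (f : N.-tuple X -> R) (s : seq X) : R :=
  max_of [set tree_cexp t f s | t in compatible C].

Definition upper_exp (R : realType) (X : finType) (N : nat) (C : imc R X N)
    (f : N.-tuple X -> R) : R :=
  max_of [set tree_exp (horizon_gt0 C) t f | t in compatible C].

Definition at_time (R : realType) (X : finType) (N n : nat)
    (Hn : (0 < n <= N)%N) (h : X -> R) : N.-tuple X -> R :=
  fun y => h (tnth y (time_index Hn)).

Lemma max_ofP (R : realType) (S : set R) (v : R) :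
  S v -> ubound S v -> max_of S = v.
Proof.
move=> Sv uv; rewrite /max_of; apply: xget_unique => // w [Sw uw].
by apply/eqP; rewrite eq_le uv //= uw.
Qed.

Lemma credal_compact (R : realType) (X : finType) (M : set (X -> R)) :
  credal_set M -> @compact {ptws X -> R} M.
Proof.
move=> [_ clM _ Mpmf].
apply: (@subclosed_compact {ptws X -> R} M
  [set f | forall x : X, `[0%R, 1%R]%classic (f x)]) => //.
  exact: (@tychonoff X (fun=> R) (fun=> `[0%R, 1%R]%classic)
    (fun=> @segment_compact R 0 1)).
move=> m /Mpmf [m0 m1] x /=; rewrite in_itv /= m0 /= -m1.
by rewrite (bigD1 x) //= lerDl sumr_ge0.
Qed.

Lemma has_max_ofP (R : realType) (S : set R) :
  S `&` ubound S !=set0 -> S (max_of S) /\ ubound S (max_of S).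
Proof. by move=> [v vP]; exact: (xgetI 0 vP). Qed.

Lemma compact_max (R : realType) (T : topologicalType) (f : T -> R)
    (A : set T) : A !=set0 -> compact A -> continuous f ->
  f @` A `&` ubound (f @` A) !=set0.
Proof.
move=> A0 cA cf; have [//|//||c cA' cP] := @compact_EVT_max T R f A.
  exact: continuous_subspaceT.
exists (f c); split; first by exists c => //; exact: set_mem.
by move=> _ [t At <-]; apply/cP/mem_set.
Qed.

Lemma continuous_mul (R : realType) (T : topologicalType) (f g : T -> R) :
  continuous f -> continuous g -> continuous (fun t => f t * g t).
Proof. by move=> cf cg t; apply: cvgM; [exact: cf|exact: cg]. Qed.

Lemma continuous_lin (R : realType) (T : topologicalType) (I : finType)
    (Q : pred I) (a : I -> R) (F : I -> T -> R) :
  (forall i, continuous (F i)) ->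
  continuous (fun t => \sum_(i | Q i) a i * F i t).
Proof.
move=> cF; apply: continuous_big; first exact: add_continuous.
by move=> i _; apply: continuous_mul => // t; exact: cvg_cst.
Qed.

Lemma credal_max (R : realType) (X : finType) (M : set (X -> R)) (h : X -> R)
    (S := [set \sum_x h x * m x | m in M]) :
  credal_set M -> S (max_of S) /\ ubound S (max_of S).
Proof.
move=> cM; apply: has_max_ofP.
apply: (@compact_max R {ptws X -> R} (fun m => \sum_x h x * m x)).
- by case: cM.
- exact: credal_compact.
- apply: (@continuous_lin R {ptws X -> R} X xpredT h (fun x m => m x)) => x.
  exact: (@proj_continuous X (fun=> R) x).
Qed.

(* Trees as points of a product space: None stands for the initial mass
   function, Some s for the one at s; it is set to 0 at irrelevant histories. *)
Section TreeMax.
Variables (R : realType) (X : finType) (N : nat) (C : imc R X N).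

Let relevant (s : seq X) := (0 < size s < N)%N.

Let P := prod_topology (fun _ : option (seq X) => {ptws X -> R}).

Let dom (i : option (seq X)) : set {ptws X -> R} :=
  if i is Some s then
    if s is x :: s' then
      if relevant s then imc_trans C (size s) (last x s') else [set fun=> 0]
    else [set fun=> 0]
  else imc_init C.

Let tree_of (p : P) : prob_tree R X :=
  ProbTree (p None) (fun s => p (Some s)).

Let trees : set P := [set p | forall i, dom i (p i)].

Let trees_compact : compact trees.
Proof.
apply: (@tychonoff _ (fun=> {ptws X -> R}) dom) => -[[|x s]|] /=.
- exact: compact_set1.
- case: ifP => rs; last exact: compact_set1.
  exact/credal_compact/imc_trans_credal.
- exact/credal_compact/imc_init_credal.
Qed.

Let trees_nonempty : trees !=set0.
Proof.
have H i : exists m, dom i m.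
  case: i => [[|x s]|] /=; first by exists (fun=> 0).
    case: ifP => rs; last by exists (fun=> 0).
    by have [[m]] := imc_trans_credal C (last x s) rs; exists m.
  by have [[m]] := imc_init_credal C; exists m.
by exists (fun i => sval (cid (H i))) => i; exact: (svalP (cid (H i))).
Qed.

Let tree_ofP (p : P) : trees p -> compatible C (tree_of p).
Proof.
move=> tp; split; first exact: (tp None).
move=> s x sN; have := tp (Some (rcons s x)) => /=.
have: relevant (rcons s x) by rewrite /relevant size_rcons.
case E : (rcons s x) => [|y s'] /=; first by case: s {sN} E.
move=> ->; have -> : (size s').+1 = (size s).+1.
  by rewrite -[LHS]/(size (y :: s')) -E size_rcons.
by rewrite -[last y s']/(last y (y :: s')) -E last_rcons.
Qed.

Let tree_ofK (t : prob_tree R X) : compatible C t ->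
  exists p, [/\ trees p, tree_init (tree_of p) = tree_init t &
    forall s, relevant s -> tree_trans (tree_of p) s = tree_trans t s].
Proof.
move=> [ti tt]; exists (fun i => if i is Some s then
    if relevant s then tree_trans t s else fun=> 0 else tree_init t).
split=> //= [|s ->//] [s|//]; case: s => [|x s] //=; case: ifP => // rs.
have := tt (belast x s) (last x s).
by rewrite size_belast -lastI; apply; case/andP: rs.
Qed.

Let coord_continuous i x : continuous (fun p : P => p i x).
Proof.
move=> p.
have ci := @proj_continuous _ (fun _ : option (seq X) => {ptws X -> R}) i p.
have cx := @proj_continuous X (fun=> R) x (p i).
exact: (@continuous_comp P {ptws X -> R} R _ (fun m => m x) p ci cx).
Qed.

Let prod_continuous (y : N.-tuple X) (Q : pred 'I_N) :
  continuous (fun p : P => \prod_(k < N | Q k)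
    tree_trans (tree_of p) (take k y) (tnth y k)).
Proof.
apply: continuous_big; first exact: mul_continuous.
by move=> k _; exact: coord_continuous.
Qed.

Let take_relevant (y : N.-tuple X) (k : 'I_N) :
  (0 < k)%N -> relevant (take k y).
Proof. by rewrite /relevant size_takel ?size_tuple ?ltn_ord ?andbT // ltnW. Qed.

Let max_transfer (F : prob_tree R X -> R) (S := [set F t | t in compatible C]) :
  (forall t u, tree_init t = tree_init u ->
    (forall s, relevant s -> tree_trans t s = tree_trans u s) -> F t = F u) ->
  continuous (F \o tree_of) -> S (max_of S) /\ ubound S (max_of S).
Proof.
move=> Fext Fcont; apply: has_max_ofP.
have [v [[p tp <-] vP]] := compact_max trees_nonempty trees_compact Fcont.
exists (F (tree_of p)); split; first by exists (tree_of p) => //; exact: tree_ofP.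
move=> _ [t /tree_ofK [q [tq qi qt]] <-].
by rewrite -(Fext _ _ qi qt); apply: vP; exists q.
Qed.

Lemma upper_cexp_max (f : N.-tuple X -> R) (s : seq X)
    (S := [set tree_cexp t f s | t in compatible C]) :
  (0 < size s)%N -> S (upper_cexp C f s) /\ ubound S (upper_cexp C f s).
Proof.
move=> s0; apply: max_transfer => [t u _ tu|].
  apply: eq_bigr => y _; congr (_ * _); apply: eq_bigr => k sk.
  by rewrite tu // take_relevant // (leq_trans s0).
apply: (@continuous_lin R P) => y; exact: prod_continuous.
Qed.

Lemma upper_exp_max (f : N.-tuple X -> R)
    (S := [set tree_exp (horizon_gt0 C) t f | t in compatible C]) :
  S (upper_exp C f) /\ ubound S (upper_exp C f).
Proof.
apply: max_transfer => [t u ti tu|].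
  apply: eq_bigr => y _; rewrite ti; congr (_ * (_ * _)).
  by apply: eq_bigr => k sk; rewrite tu // take_relevant.
apply: (@continuous_lin R P) => y.
apply: (@continuous_mul R P); first exact: coord_continuous.
exact: prod_continuous.
Qed.

End TreeMax.

(* Main.v *)
Require Import Defs.
From mathcomp Require Import all_boot all_order all_algebra.
From mathcomp Require Import all_classical all_reals all_analysis.

(** Fix a probability tree.  By the law of iterated expectations, the
    expectation given a history [s] is the average, under the mass function
    that the tree attaches to [s], of the expectations given the histories
    [rcons s z] ([tree_cexp_step]); averaging these over the first state with
    the initial mass function gives the unconditional expectation
    ([tree_expE]).  Once time [n] lies in the past, the expectation of
    [h (X_n)] is just the observed value ([tree_cexp_const]).

    Going backwards in time from [n], each averaging step at time [k] is bounded
    by the upper transition operator [T_k], so every compatible tree has its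
    expectation below the iterated operator ([tree_cexp_le]).  Conversely, since
    the operators are maxima, one may choose in each situation a mass function
    attaining [T_k (T_(k+1) ... (T_(n-1) h))]; these choices may be made
    independently of each other, so they form a single compatible tree
    ([optimal_tree]), for which all the bounds are equalities
    ([tree_cexp_optimal]). *)

Set Implicit Arguments.
Unset Strict Implicit.
Unset Printing Implicit Defensive.

Import Order.TTheory GRing.Theory Num.Theory.

Local Open Scope classical_set_scope.
Local Open Scope ring_scope.

Section Expectations.
Variables (R : realType) (X : finType) (N : nat).
Implicit Types (t : prob_tree R X) (f : N.-tuple X -> R).

Lemma prefix_rcons_tnth (s : seq X) (y : N.-tuple X) (i : 'I_N) (z : X) :
  size s = i -> prefix (rcons s z) y = prefix s y && (tnth y i == z).
Proof.
move=> si; rewrite !prefixE size_rcons (take_nth z) ?size_tuple ?si //.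
by rewrite eqseq_rcons (tnth_nth z).
Qed.

(** The law of iterated expectations. *)
Lemma tree_cexp_step t f (s : seq X) : (size s < N)%N ->
  tree_cexp t f s = \sum_z tree_cexp t f (rcons s z) * tree_trans t s z.
Proof.
move=> sN; pose i := Ordinal sN; rewrite /tree_cexp.
rewrite (partition_big (fun y : N.-tuple X => tnth y i) xpredT) //=.
apply: eq_bigr => z _; rewrite big_distrl /=; apply: eq_big => y.
  by rewrite (@prefix_rcons_tnth s y i z).
move=> /andP[]; rewrite prefixE => /eqP sy /eqP yz.
rewrite (bigD1 i) //= sy yz -mulrA [tree_trans t s z * _]mulrC.
congr (_ * (_ * _)); apply: eq_bigl => k.
by rewrite size_rcons ltn_neqAle -val_eqE /= eq_sym andbC.
Qed.

Lemma tree_cexp_full t f (y : N.-tuple X) : tree_cexp t f y = f y.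
Proof.
rewrite /tree_cexp (big_pred1 y) => [|z /=].
  by rewrite big_pred0 ?mulr1 // => k; rewrite size_tuple leqNgt ltn_ord.
by rewrite prefixE size_tuple take_oversize ?size_tuple.
Qed.

Lemma tree_expE (N_gt0 : (0 < N)%N) t f :
  tree_exp N_gt0 t f = \sum_z tree_cexp t f [:: z] * tree_init t z.
Proof.
rewrite /tree_exp /tree_cexp; pose i := Ordinal N_gt0.
rewrite (partition_big (fun y : N.-tuple X => tnth y i) xpredT) //=.
apply: eq_bigr => z _; rewrite big_distrl /=; apply: eq_big => y.
  by rewrite (@prefix_rcons_tnth [::] y i z) // prefix0s.
by move=> /eqP ->; rewrite -mulrA [tree_init t z * _]mulrC.
Qed.

End Expectations.

Section MarkovChain.
Variables (R : realType) (X : finType) (N : nat) (C : imc R X N).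
Implicit Types (t : prob_tree R X) (f : N.-tuple X -> R) (s : seq X).

Lemma upper_trans_iter_nn (n : nat) (h : X -> R) :
  upper_trans_iter C n n h = h.
Proof. by rewrite /upper_trans_iter /index_iota subnn. Qed.

Lemma upper_trans_iterS (l n : nat) (h : X -> R) : (l < n)%N ->
  upper_trans_iter C l n h = upper_trans C l (upper_trans_iter C l.+1 n h).
Proof. by move=> ln; rewrite /upper_trans_iter /index_iota -(subnSK ln). Qed.

Lemma upper_trans_ge (k : nat) (x : X) (g q : X -> R) : (0 < k < N)%N ->
  imc_trans C k x q -> \sum_z g z * q z <= upper_trans C k g x.
Proof.
move=> kN Cq; have [_] := credal_max g (imc_trans_credal C x kN).
by apply; exists q.
Qed.

Lemma upper_init_ge (g m : X -> R) :
  imc_init C m -> \sum_z g z * m z <= upper_init C g.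
Proof.
move=> Cm; have [_] := credal_max g (imc_init_credal C).
by apply; exists m.
Qed.

(** A variable that is constant on the continuations of a history has that
    constant as its expectation, since the mass functions in the remaining
    situations sum to 1. *)
Lemma tree_cexp_const t f s (x : X) (c : R) :
  compatible C t -> (size s < N)%N ->
  (forall y : N.-tuple X, prefix (rcons s x) y -> f y = c) ->
  tree_cexp t f (rcons s x) = c.
Proof.
(* Induction on the number of states still to come. *)
move=> [_ Ct] sN; move: {2}(N - (size s).+1)%N (erefl (N - (size s).+1)%N).
move=> d; elim: d s x sN => [|d IHd] s x sN dE fc.
  have sxN : size (rcons s x) == N.
    by rewrite size_rcons eqn_leq sN -subn_eq0 dE.
  by rewrite -[rcons s x]/(tval (Tuple sxN)) tree_cexp_full fc ?prefix_refl.
have sN' : ((size s).+1 < N)%N by rewrite -subn_gt0 dE.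
have [_ _ _ Qpmf] := imc_trans_credal C (n := (size s).+1) x sN'.
have [_ q1] := Qpmf _ (Ct s x sN').
rewrite tree_cexp_step ?size_rcons // -[RHS]mulr1 -q1 big_distrr /=.
apply: eq_bigr => z _; rewrite IHd ?size_rcons // => [|y szy].
  by rewrite subnS dE.
by apply: fc; apply: prefix_trans szy; apply: prefix_rcons.
Qed.

(** The present state, at time [n], determines [h (X_n)]. *)
Lemma tree_cexp_present t (n : nat) (Hn : (0 < n <= N)%N) (h : X -> R) s
    (x : X) : compatible C t -> (size s).+1 = n ->
  tree_cexp t (at_time Hn h) (rcons s x) = h x.
Proof.
move=> Ct sn; have [_ nN] := andP Hn.
apply: tree_cexp_const => //; first by rewrite sn.
move=> y; rewrite (@prefix_rcons_tnth _ _ _ _ (time_index Hn)) /= -?sn //.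
by rewrite /at_time => /andP[_ /eqP ->].
Qed.

Lemma tree_cexp_le t (n : nat) (Hn : (0 < n <= N)%N) (h : X -> R) s (x : X) :
  compatible C t -> (size s < n)%N ->
  tree_cexp t (at_time Hn h) (rcons s x)
    <= upper_trans_iter C (size s).+1 n h x.
Proof.
move=> Ct sn; have [_ nN] := andP Hn.
(* Induction on the number of time steps left until [n]. *)
move: {2}(n - (size s).+1)%N (erefl (n - (size s).+1)%N) => d.
elim: d s x sn => [|d IHd] s x sn dE.
  have {}sn : (size s).+1 = n by apply/eqP; rewrite eqn_leq sn -subn_eq0 dE.
  by rewrite tree_cexp_present // sn upper_trans_iter_nn.
have sn' : ((size s).+1 < n)%N by rewrite -subn_gt0 dE.
have sN := leq_trans sn' nN.
have Cq := Ct.2 s x sN.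
rewrite tree_cexp_step ?size_rcons // upper_trans_iterS //.
apply: le_trans (upper_trans_ge _ _ Cq) => //.
have [_ _ _ Qpmf] := imc_trans_credal C (n := (size s).+1) x sN.
apply: ler_sum => z _; apply: ler_wpM2r; first by have [] := Qpmf _ Cq.
by rewrite -(size_rcons s x) IHd ?size_rcons // subnS dE.
Qed.

(** A compatible tree attaining the upper transition operator of every time [k]
    at the map [g k], and the upper initial expectation at [g 0]. *)
Lemma optimal_tree (g : nat -> X -> R) :
  exists t, [/\ compatible C t,
    \sum_z g 0%N z * tree_init t z = upper_init C (g 0%N) &
    forall s x, ((size s).+1 < N)%N ->
      \sum_z g (size s).+1 z * tree_trans t (rcons s x) z
        = upper_trans C (size s).+1 (g (size s).+1) x].
Proof.
have [[m Cm mE] _] := credal_max (g 0%N) (imc_init_credal C).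
have /choice[q qP] : forall r, exists q : X -> R, forall s x,
    r = rcons s x -> ((size s).+1 < N)%N ->
    imc_trans C (size s).+1 x q /\
    \sum_z g (size s).+1 z * q z = upper_trans C (size s).+1 (g (size s).+1) x.
  case/lastP=> [|s x]; first by exists (fun=> 0) => -[].
  have [sN|sN] := boolP ((size s).+1 < N)%N; last first.
    exists (fun=> 0) => s' x' /rcons_inj[<- _] sN'.
    by rewrite sN' in sN.
  have [[q Cq qE] _] :=
    credal_max (g (size s).+1) (imc_trans_credal C (n := (size s).+1) x sN).
  by exists q => s' x' /rcons_inj[<- <-].
exists (ProbTree m q); split=> //=.
  by split=> // s x sN; have [] := qP _ s x erefl sN.
by move=> s x sN; have [] := qP _ s x erefl sN.
Qed.

(** In a tree attaining every [T_k] at the map [T_(k+1) ... T_(n-1) h], the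
    bound of [tree_cexp_le] is an equality. *)
Lemma tree_cexp_optimal t (n : nat) (Hn : (0 < n <= N)%N) (h : X -> R) s
    (x : X) : compatible C t ->
  (forall s x, ((size s).+1 < N)%N ->
    \sum_z upper_trans_iter C (size s).+2 n h z * tree_trans t (rcons s x) z
    = upper_trans C (size s).+1 (upper_trans_iter C (size s).+2 n h) x) ->
  (size s < n)%N ->
  tree_cexp t (at_time Hn h) (rcons s x) = upper_trans_iter C (size s).+1 n h x.
Proof.
move=> Ct topt sn; have [_ nN] := andP Hn.
(* Induction on the number of time steps left until [n]. *)
move: {2}(n - (size s).+1)%N (erefl (n - (size s).+1)%N) => d.
elim: d s x sn => [|d IHd] s x sn dE.
  have {}sn : (size s).+1 = n by apply/eqP; rewrite eqn_leq sn -subn_eq0 dE.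
  by rewrite tree_cexp_present // sn upper_trans_iter_nn.
have sn' : ((size s).+1 < n)%N by rewrite -subn_gt0 dE.
have sN := leq_trans sn' nN.
rewrite tree_cexp_step ?size_rcons // upper_trans_iterS // -topt //.
apply: eq_bigr => z _; congr (_ * _).
by rewrite IHd ?size_rcons // subnS dE.
Qed.

End MarkovChain.

Theorem corollary3p3 (R : realType) (X : finType) (X_gt0 : (0 < #|X|)%N)
    (N : nat) (C : imc R X N) (h : X -> R)
    (n ell : nat) (Hn : (0 < n <= N)%N) (Hell : (0 < ell < n)%N) (x : X) :
  (forall xs : (ell.-1).-tuple X,
     upper_cexp C (at_time Hn h) (rcons xs x) = upper_trans_iter C ell n h x)
  /\ upper_exp C (at_time Hn h) = upper_init C (upper_trans_iter C 1 n h).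
Proof.
(* The mass functions at time [k], the initial one being that of [k = 0], must
   be optimal for [T_(k+1) ... T_(n-1) h]; from time [n] on this map is [h], and
   which mass functions are chosen does not matter. *)
have [t [Ct tinit topt]] :=
  optimal_tree C (fun k => upper_trans_iter C k.+1 n h).
have [n_gt0 _] := andP Hn; split=> [xs|].
  have [ell_gt0 elln] := andP Hell.
  have sE : (size xs).+1 = ell by rewrite size_tuple prednK.
  have sn : (size xs < n)%N by rewrite sE ltnW.
  have -> : upper_trans_iter C ell n h x =
            upper_trans_iter C (size xs).+1 n h x.
    by rewrite sE.
  apply: max_ofP.
    by exists t => //; apply: tree_cexp_optimal.
  by move=> _ [u Cu <-]; apply: tree_cexp_le.
apply: max_ofP.
  exists t => //; rewrite tree_expE -tinit; apply: eq_bigr => z _.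
  by rewrite (@tree_cexp_optimal _ _ _ C t n Hn h [::] z).
move=> _ [u Cu <-]; rewrite tree_expE; apply: le_trans (upper_init_ge _ Cu.1).
have [_ _ _ Mpmf] := imc_init_credal C.
apply: ler_sum => z _; apply: ler_wpM2r; first by have [] := Mpmf _ Cu.1.
exact: (@tree_cexp_le _ _ _ C u n Hn h [::] z).
Qed.
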